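(* There exists a sequence of polynomials $p_n(\alpha)$, $n = 1,2,3,\dots$, in one variable $\alpha$ such that: (1) for each $n\ge 1$, $p_n(\alpha)$ is a monic polynomial of degree $n$ with integer coefficients; (2) for each $n \ge 1$, all roots of $p_n(\alpha)$ are distinct real numbers (i.e. $p_n$ has $n$ distinct roots, all real) and every root is a relation number; (3) if $\alpha_n$ denotes the maximal root of $p_n(\alpha)$, then the sequence $\{\alpha_n\}_{n=1}^\infty$ is increasing and converges to $4$.
   Context: For $\alpha\in\mathbb{C}$ let $A=\begin{bmatrix}1&1\\0&1\end{bmatrix}$, $B_\alpha=\begin{bmatrix}1&0\\ \alpha&1\end{bmatrix}$, and let $G_\alpha=\langle A,B_\alpha\rangle\subset \mathrm{SL}_2(\mathbb{C})$. The number $\alpha$ is called a free number if $G_\alpha$ is isomorphic to the free group of rank $2$; otherwise $\alpha$ is called a relation number. *)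

(* Defs.v *)
From HB Require Import structures.
From mathcomp Require Import all_boot all_order all_algebra.
From mathcomp Require Import all_classical all_reals all_analysis.
From mathcomp Require Import complex.

Set Implicit Arguments.
Unset Strict Implicit.
Unset Printing Implicit Defensive.

Import Order.TTheory GRing.Theory Num.Theory.
Import numFieldNormedType.Exports.

Local Open Scope classical_set_scope.
Local Open Scope ring_scope.

(* The free group on T, realised as the reduced words over the letters        *)
(* (t, true) = t and (t, false) = t^-1, multiplied by concatenation followed  *)
(* by free reduction.                                                         *)
Section FreeGroup.
Variable T : choiceType.

Definition letter : Type := (T * bool)%type.
Implicit Types (x y : letter) (u v w : seq (T * bool)).

Definition letter_inv (x : letter) : letter := (x.1, ~~ x.2).

Definition reduced (w : seq (T * bool)) : bool :=
  sorted (fun x y : T * bool => y != letter_inv x) w.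

Definition push (x : letter) (w : seq (T * bool)) : seq (T * bool) :=
  if w is y :: w' then if y == letter_inv x then w' else x :: w else [:: x].

Definition word_mul u v : seq (T * bool) := foldr push v u.

Definition word_inv u : seq (T * bool) := rev (map letter_inv u).

Lemma letter_invK : involutive letter_inv.
Proof. by case=> t b; rewrite /letter_inv /= negbK. Qed.

Lemma reduced_push x w : reduced w -> reduced (push x w).
Proof.
case: w => [//|y w] /= rw; case: ifPn => [_|yx]; first exact: path_sorted rw.
by rewrite /= yx.
Qed.

Lemma reduced_mul u v : reduced v -> reduced (word_mul u v).
Proof. by move=> rv; elim: u => //= x u; exact: reduced_push. Qed.

Lemma reduced_inv u : reduced u -> reduced (word_inv u).
Proof.
move=> ru; rewrite /reduced /word_inv rev_sorted sorted_map.
apply: sub_sorted ru => x y /= /eqP yx; apply/eqP => e; apply: yx.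
by rewrite letter_invK in e; rewrite e.
Qed.

Lemma pushVK x w : reduced w -> push (letter_inv x) (push x w) = w.
Proof.
case: w => [_|y w] /=; first by rewrite letter_invK eqxx.
case: ifPn => [/eqP ->|_ _] /=; last by rewrite letter_invK eqxx.
case: w => [//|z w] /= /andP[+ _].
by move/negbTE ->.
Qed.

Lemma pushKV x w : reduced w -> push x (push (letter_inv x) w) = w.
Proof. by move=> rw; rewrite -{1}(letter_invK x) pushVK. Qed.

Lemma mul_push x u w :
  reduced w -> word_mul (push x u) w = push x (word_mul u w).
Proof.
case: u => [//|y u] rw /=; case: ifPn => [/eqP ->|//].
by rewrite pushKV // reduced_mul.
Qed.

Lemma word_mulA u v w : reduced w ->
  word_mul u (word_mul v w) = word_mul (word_mul u v) w.
Proof. by move=> rw; elim: u => //= x u ->; rewrite mul_push. Qed.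

Lemma word_mulw0 u : reduced u -> word_mul u [::] = u.
Proof.
elim: u => //= x u IH rxu; rewrite IH; last exact: path_sorted rxu.
by case: u rxu {IH} => //= y u /andP[/negbTE ->].
Qed.

Lemma word_mulVw u : reduced u -> word_mul (word_inv u) u = [::].
Proof.
rewrite /word_inv; elim: u => //= x u IH rxu.
rewrite rev_cons -cats1 /word_mul foldr_cat /= letter_invK eqxx.
by apply: IH; exact: path_sorted rxu.
Qed.

Lemma word_invK u : word_inv (word_inv u) = u.
Proof.
by rewrite /word_inv map_rev revK -map_comp map_id_in // => x _ /=; rewrite letter_invK.
Qed.

Lemma word_mulwV u : reduced u -> word_mul u (word_inv u) = [::].
Proof. by move=> /reduced_inv /word_mulVw; rewrite word_invK. Qed.

Record free_group := FreeWord {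
  free_word :> seq (T * bool);
  free_wordP : reduced free_word }.

HB.instance Definition _ := [isSub for free_word].
HB.instance Definition _ := [Choice of free_group by <:].

Definition free_one : free_group := @FreeWord [::] isT.
Definition free_mul (u v : free_group) : free_group :=
  FreeWord (reduced_mul u (free_wordP v)).
Definition free_inv (u : free_group) : free_group :=
  FreeWord (reduced_inv (free_wordP u)).

Lemma free_mulA : associative free_mul.
Proof. by move=> u v w; apply: val_inj; exact: word_mulA (free_wordP w). Qed.

Lemma free_mul1g : left_id free_one free_mul.
Proof. by move=> u; apply: val_inj. Qed.

Lemma free_mulg1 : right_id free_one free_mul.
Proof. by move=> u; apply: val_inj; exact: word_mulw0 (free_wordP u). Qed.

Lemma free_mulVg : left_inverse free_one free_inv free_mul.
Proof. by move=> u; apply: val_inj; exact: word_mulVw (free_wordP u). Qed.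

Lemma free_mulgV : right_inverse free_one free_inv free_mul.
Proof. by move=> u; apply: val_inj; exact: word_mulwV (free_wordP u). Qed.

HB.instance Definition _ := isGroup.Build free_group
  free_mulA free_mul1g free_mulg1 free_mulVg free_mulgV.

End FreeGroup.

Section SpecialLinear.
Variables (n : nat) (K : comUnitRingType).

Record SL := MkSL { SLval :> 'M[K]_n; SLvalP : \det SLval == 1 }.

HB.instance Definition _ := [isSub for SLval].
HB.instance Definition _ := [Choice of SL by <:].

Lemma SL_unit (M : SL) : (M : 'M[K]_n) \in unitmx.
Proof. by rewrite unitmxE (eqP (SLvalP M)) unitr1. Qed.

Fact SL_one_subproof : \det (1%:M : 'M[K]_n) == 1.
Proof. by rewrite det1. Qed.

Fact SL_mul_subproof (M N : SL) : \det (M *m N) == 1.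
Proof. by rewrite det_mulmx (eqP (SLvalP M)) (eqP (SLvalP N)) mulr1. Qed.

Fact SL_inv_subproof (M : SL) : \det (invmx M) == 1.
Proof. by rewrite det_inv (eqP (SLvalP M)) invr1. Qed.

Definition SL_one : SL := MkSL SL_one_subproof.
Definition SL_mul (M N : SL) : SL := MkSL (SL_mul_subproof M N).
Definition SL_inv (M : SL) : SL := MkSL (SL_inv_subproof M).

Lemma SL_mulA : associative SL_mul.
Proof. by move=> M N P; apply: val_inj; exact: mulmxA. Qed.

Lemma SL_mul1g : left_id SL_one SL_mul.
Proof. by move=> M; apply: val_inj; exact: mul1mx. Qed.

Lemma SL_mulg1 : right_id SL_one SL_mul.
Proof. by move=> M; apply: val_inj; exact: mulmx1. Qed.

Lemma SL_mulVg : left_inverse SL_one SL_inv SL_mul.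
Proof. by move=> M; apply: val_inj; exact: mulVmx (SL_unit M). Qed.

Lemma SL_mulgV : right_inverse SL_one SL_inv SL_mul.
Proof. by move=> M; apply: val_inj; exact: mulmxV (SL_unit M). Qed.

HB.instance Definition _ := isGroup.Build SL
  SL_mulA SL_mul1g SL_mulg1 SL_mulVg SL_mulgV.

End SpecialLinear.

Definition is_subgroup (G : groupType) (H : set G) : Prop :=
  [/\ H 1%g, (forall x y, H x -> H y -> H (x * y)%g)
    & (forall x, H x -> H x^-1%g)].

Definition subgroup_generated (G : groupType) (S : set G) : set G :=
  smallest (@is_subgroup G) S.

(* Some group isomorphism from F onto H exists; in free_number below it need  *)
(* not send the canonical generators of the free group to A and B_alpha.      *)
Definition group_iso (F G : groupType) (H : set G) : Prop :=
  exists f : {multiplicative F -> G}, set_bij [set: F] H f.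

Section Generators.
Variables (R : realType) (alpha : R[i]).

Definition mxA : 'M[R[i]]_2 :=
  \matrix_(i < 2, j < 2) (nth [::] [:: [:: 1; 1]; [:: 0; 1]] i)`_j.
Definition mxB : 'M[R[i]]_2 :=
  \matrix_(i < 2, j < 2) (nth [::] [:: [:: 1; 0]; [:: alpha; 1]] i)`_j.

Fact det_mxA : \det mxA == 1.
Proof.
rewrite (expand_det_row _ ord0) !big_ord_recl big_ord0 /cofactor !det_mx11.
by rewrite !mxE /= expr0 !mul1r mulr0 !addr0.
Qed.

Fact det_mxB : \det mxB == 1.
Proof.
rewrite (expand_det_row _ ord0) !big_ord_recl big_ord0 /cofactor !det_mx11.
by rewrite !mxE /= expr0 !mul1r mul0r !addr0.
Qed.

Definition matA : SL 2 R[i] := MkSL det_mxA.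
Definition matB : SL 2 R[i] := MkSL det_mxB.

Definition G_alpha : set (SL 2 R[i]) := subgroup_generated [set matA; matB].

Definition free_number : Prop := group_iso (free_group 'I_2) G_alpha.

Definition relation_number : Prop := ~ free_number.

End Generators.

(* Main.v *)
(* Take p_n(a) = U_n((a - 2)/2), U_n being the Chebyshev polynomial of the     *)
(* second kind.  Its roots are 2 + 2 cos(k pi/(n+1)) for 1 <= k <= n, and the  *)
(* largest one, 2 + 2 cos(pi/(n+1)), increases to 4.  The matrix N = -A B^-1   *)
(* has determinant 1 and trace a - 2, so by Cayley-Hamilton                    *)
(* N^(n+1) = p_n(a) N - p_(n-1)(a).  At a root a of p_n this is a scalar       *)
(* matrix of determinant 1, hence A B^-1 is a nontrivial torsion element of    *)
(* G_a, whereas free groups are torsion-free.                                  *)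
Require Import Defs.
From HB Require Import structures.
From mathcomp Require Import all_boot all_order all_algebra.
From mathcomp Require Import all_classical all_reals all_analysis.
From mathcomp Require Import complex ring.

Set Implicit Arguments.
Unset Strict Implicit.
Unset Printing Implicit Defensive.

Import Order.TTheory GRing.Theory Num.Theory.
Import numFieldNormedType.Exports.

Local Open Scope classical_set_scope.
Local Open Scope ring_scope.

(** The recurrence makes p_n monic over the integers. Substituting a = 2 + 2 cos t turns it into a
    sine addition formula ([chebU_at_cos]), which exhibits n real zeros; a degree count
    ([root_chebU]) leaves no others, and monotonicity of cosine ([chebU_root_lt]) orders them,
    within one n and across different n. At a zero, [chebU_root_torsion] and [matAB_neq1] give a
    nontrivial torsion element of the group, which [free_group_torsion_free] forbids under any
    isomorphism with a free group. *)

(** * Torsion-freeness of free groups *)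

Section FreeGroupTorsion.
Variable T : choiceType.
Implicit Types (x y : T * bool) (u v w : seq (T * bool)).

Lemma word_mul_cat u v : reduced (u ++ v) -> word_mul u v = u ++ v.
Proof.
elim: u => //= x u IH ruv; rewrite IH; last exact: path_sorted ruv.
by case: (u ++ v) ruv => //= y w /andP[/negbTE ->].
Qed.

(** For a cyclically reduced word nothing cancels at the seams between copies. *)
Lemma free_word_cyclic_expg (g : free_group T) x w n :
  free_word g = x :: w -> last x w != letter_inv x ->
  free_word (g ^+ n)%g = flatten (nseq n (x :: w)).
Proof.
move=> gE cyc; elim: n => [|n IH]; first by rewrite expg0.
rewrite expgS [LHS]/= IH gE -[RHS]/((x :: w) ++ flatten (nseq n (x :: w))).
apply: word_mul_cat; rewrite /reduced /= cat_path.
have := free_wordP g; rewrite gE /reduced /= => -> /=.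
have := free_wordP (g ^+ n)%g; rewrite IH.
case: n {IH} => //= n; rewrite /reduced /= => ->; rewrite andbT.
by apply: contra_neq cyc => /(congr1 (@letter_inv T)); rewrite letter_invK.
Qed.

(** Induction on word length: if the end letters cancel, [g] is a conjugate of a shorter word [V];
    otherwise its powers are visibly nonempty words. *)
Lemma free_group_torsion_free (g : free_group T) n :
  (0 < n)%N -> (g ^+ n = 1)%g -> g = 1%g.
Proof.
move=> n_gt0; have [m] := ubnP (size (free_word g)).
elim: m g => // m IH g; case gE: (free_word g) => [|x w] /= le_m gn1.
  by apply: val_inj.
have [lastE|cyc] := eqVneq (last x w) (letter_inv x).
  case: (lastP w) lastE gE le_m => [xE|v y].
    by have := congr1 snd xE; rewrite /=; case: x.2.
  rewrite last_rcons size_rcons => -> gE le_m.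
  have := free_wordP g; rewrite gE /reduced /= => /path_sorted rv'.
  have rv : reduced v.
    by move: rv'; rewrite -cats1 => /cat_sorted2[].
  pose V := FreeWord rv; pose X := @FreeWord T [:: x] isT.
  have gV : g = (X * (V * X^-1))%g.
    apply: val_inj; rewrite /= gE.
    have -> : word_inv [:: x] = [:: letter_inv x] by [].
    rewrite word_mul_cat cats1 //.
    have := free_wordP g; rewrite gE /reduced /=.
    by case: (rcons v _) => //= z s /andP[/negbTE ->].
  have gJ : g = (V ^ X^-1)%g by rewrite /conjg invgK.
  have V1 : V = 1%g.
    apply: IH; first exact: ltnW.
    by apply: (conjg_inj X^-1%g); rewrite conjXg -gJ conj1g.
  by rewrite gJ V1 conj1g.
have := free_word_cyclic_expg n gE cyc; rewrite gn1.
by case: n n_gt0 {IH gn1}.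
Qed.

End FreeGroupTorsion.

(** * The polynomials p_n *)

(** The Chebyshev recurrence in y, with 2y replaced by X - 2; this absorbs the powers of 2 in the
    leading coefficients. *)
Fixpoint chebU (n : nat) : {poly int} :=
  match n with
  | 0 => 1
  | m.+1 => match m with
            | 0 => 'X - 2%:P
            | k.+1 => ('X - 2%:P) * chebU m - chebU k
            end
  end.

Lemma chebUSS n : chebU n.+2 = ('X - 2%:P) * chebU n.+1 - chebU n.
Proof. by []. Qed.

Lemma chebU_monic_size n : chebU n \is monic /\ size (chebU n) = n.+1.
Proof.
(* The recurrence reaches two steps back, so the induction carries consecutive pairs. *)
suff [] : (chebU n \is monic /\ size (chebU n) = n.+1) /\
  (chebU n.+1 \is monic /\ size (chebU n.+1) = n.+2) by [].
elim: n => [|n [[mn sn] [mn1 sn1]]].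
  by rewrite monic1 size_poly1 monicXsubC size_XsubC.
split=> //; rewrite chebUSS.
have mM : ('X - 2%:P) * chebU n.+1 \is monic by rewrite monicMl ?monicXsubC.
have sM : size (('X - 2%:P) * chebU n.+1) = n.+3.
  by rewrite size_monicM ?monicXsubC ?monic_neq0 // size_XsubC sn1.
have lt_s : (size (- chebU n)%R < size (('X - 2%:P) * chebU n.+1)%R)%N.
  by rewrite size_polyN sn sM.
by rewrite size_polyDl // sM monicE lead_coefDl // -monicE.
Qed.

Definition chebU_at {K : comNzRingType} (n : nat) (x : K) : K :=
  (map_poly intr (chebU n)).[x].

Lemma chebU_at0 {K : comNzRingType} (x : K) : chebU_at 0 x = 1.
Proof. by rewrite /chebU_at /= rmorph1 hornerC. Qed.

Lemma chebU_at1 {K : comNzRingType} (x : K) : chebU_at 1 x = x - 2.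
Proof. by rewrite /chebU_at /= rmorphB /= map_polyX map_polyC /= !hornerE. Qed.

Lemma chebU_atSS {K : comNzRingType} n (x : K) :
  chebU_at n.+2 x = (x - 2) * chebU_at n.+1 x - chebU_at n x.
Proof.
by rewrite /chebU_at chebUSS !(rmorphB, rmorphM) /= map_polyX map_polyC /= !hornerE.
Qed.

Lemma chebU_at_rmorph {K L : comNzRingType} (f : {rmorphism K -> L}) n x :
  chebU_at n (f x) = f (chebU_at n x).
Proof.
rewrite /chebU_at -horner_map -map_poly_comp; congr (_.[_]).
by apply: eq_map_poly => c /=; rewrite rmorph_int.
Qed.

(** * Real roots, their order and their limit *)

Section RealRoots.
Variable R : realType.

Lemma chebU_at_cos n (t : R) :
  chebU_at n (2 + 2 * cos t) * sin t = sin (n.+1%:R * t).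
Proof.
suff [] : chebU_at n (2 + 2 * cos t) * sin t = sin (n.+1%:R * t) /\
  chebU_at n.+1 (2 + 2 * cos t) * sin t = sin (n.+2%:R * t) by [].
elim: n => [|n [IH0 IH1]].
  rewrite chebU_at0 chebU_at1 !mul1r; split=> //.
  by rewrite [in RHS]mulr_natl sin_mulr2n; ring.
split=> //; rewrite chebU_atSS mulrBl IH0 -mulrA IH1.
have -> : n.+3%:R * t = n.+2%:R * t + t by rewrite -[in LHS]natr1; ring.
have -> : n.+1%:R * t = n.+2%:R * t - t by rewrite -[in RHS]natr1; ring.
by rewrite sinB sinD; ring.
Qed.

Definition chebU_root (n k : nat) : R := 2 + 2 * cos (pi * (k%:R / n.+1%:R)).

Lemma chebU_root_angle n k :
  (k <= n.+1)%N -> pi * (k%:R / n.+1%:R) \in `[0, pi : R].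
Proof.
move=> le_kn; rewrite in_itv /= mulr_ge0 ?pi_ge0 ?divr_ge0 //=.
by rewrite ler_piMr ?pi_ge0 // ler_pdivrMr ?ltr0n // mul1r ler_nat.
Qed.

Lemma chebU_rootP n k :
  (0 < k <= n)%N -> chebU_at n (chebU_root n k) = 0.
Proof.
case/andP=> k_gt0 le_kn; pose t : R := pi * (k%:R / n.+1%:R).
(* Since 0 < k < n + 1, t lies strictly between 0 and pi, so the factor [sin t] can be cancelled. *)
have : sin t != 0.
  rewrite gt_eqF // sin_gt0_pi // mulr_gt0 ?pi_gt0 ?divr_gt0 ?ltr0n //=.
  by rewrite gtr_pMr ?pi_gt0 // ltr_pdivrMr ?ltr0n // mul1r ltr_nat.
move=> /mulIf; apply; rewrite mul0r chebU_at_cos.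
have -> : n.+1%:R * t = k%:R * pi.
  by rewrite /t mulrCA [n.+1%:R * _]mulrC divfK ?pnatr_eq0 // mulrC.
by elim: k {k_gt0 le_kn t} => [|k IH]; rewrite ?mul0r ?sin0 // -natr1 mulrDl
  mul1r sinDpi IH oppr0.
Qed.

(** Cosine decreases strictly on [0, pi], so this compares l/(m+1) with k/(n+1), denominators
    cleared. *)
Lemma chebU_root_lt n m k l : (k <= n.+1)%N -> (l <= m.+1)%N ->
  (chebU_root n k < chebU_root m l) = (l * n.+1 < k * m.+1)%N.
Proof.
move=> le_kn le_lm; rewrite /chebU_root ltrD2l ltr_pM2l //.
rewrite ltr_cos ?chebU_root_angle // ltr_pM2l ?pi_gt0 //.
by rewrite ltr_pdivrMr // mulrAC ltr_pdivlMr // -!natrM ltr_nat.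
Qed.

Lemma chebU_root_cvg k : chebU_root n k @[n --> \oo] --> (4 : R).
Proof.
(* The angle is a constant times the harmonic sequence, so the limit is the value at angle 0. *)
have -> : 4 = 2 + 2 * cos (pi * (k%:R * 0)) :> R.
  by rewrite !mulr0 cos0; ring.
apply: cvgD; first exact: cvg_cst.
apply: cvgMr; apply: continuous_cvg; first exact: continuous_cos.
by do 2![apply: cvgMr]; exact: cvg_harmonic.
Qed.

Definition chebU_roots n : seq R[i] :=
  [seq (chebU_root n k)%:C%C | k <- iota 1 n].

Lemma chebU_roots_uniq n : uniq (chebU_roots n).
Proof.
rewrite map_inj_in_uniq ?iota_uniq // => k l.
rewrite !mem_iota add1n !ltnS => /andP[_ le_kn] /andP[_ le_ln] /complexI.
move=> /eqP; rewrite eq_le !leNgt !chebU_root_lt ?leqW // !ltn_pmul2r //.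
by rewrite -!leqNgt => kl; apply/eqP; rewrite eqn_leq andbC.
Qed.

(** One more root would give n + 1 distinct roots of a nonzero polynomial of degree n. *)
Lemma root_chebU n (z : R[i]) :
  root (map_poly intr (chebU n)) z = (z \in chebU_roots n).
Proof.
have [mn sn] := chebU_monic_size n.
have roots : all (root (map_poly intr (chebU n))) (chebU_roots n).
  apply/allP => _ /mapP[k + ->]; rewrite mem_iota add1n ltnS => kP.
  by rewrite rootE -[_.[_]]/(chebU_at _ _) chebU_at_rmorph chebU_rootP.
apply/idP/idP => [rz|]; last exact: (allP roots).
apply: contraTT isT => z_notin.
have /= := @max_poly_roots _ _ (z :: chebU_roots n)
  (monic_neq0 (monic_map intr mn)).
rewrite rz roots chebU_roots_uniq z_notin size_map size_iota.
by rewrite size_map_poly_id0 ?(monicP mn) ?rmorph1 ?oner_neq0 // sn ltnn => /(_ isT isT).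
Qed.

End RealRoots.

Section MultiplicativeGroups.
Variables (G H : groupType) (f : {multiplicative G -> H}).

Lemma mult1g : f 1%g = 1%g.
Proof. by apply: (mulgI (f 1%g)); rewrite -gmulfM !mulg1. Qed.

Lemma mult_expg x n : f (x ^+ n)%g = (f x ^+ n)%g.
Proof. by elim: n => [|n IH]; rewrite ?mult1g // !expgS gmulfM IH. Qed.

End MultiplicativeGroups.

(** * Torsion in the matrix group at a root *)

Section Torsion.
Variables (R : realType) (z : R[i]).

Lemma val_SL_expg (n : nat) (K : comUnitRingType) (g : SL n.+1 K) k :
  SLval (g ^+ k)%g = (SLval g) ^+ k.
Proof. by elim: k => // k IH; rewrite expgS exprS -IH. Qed.

Lemma invmx_mxB : invmx (mxB z) = mxB (- z).
Proof.
have BB : mxB (- z) *m mxB z = 1%:M.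
  apply/matrixP => i j; rewrite !mxE !big_ord_recl big_ord0 !mxE /=.
  by case: i => [[|[|[]]]] // ?; case: j => [[|[|[]]]] // ? /=; ring.
by rewrite -[RHS]mulmx1 -(mulmxV (SL_unit (matB z))) mulmxA BB mul1mx.
Qed.

(** The sign turns the trace 2 - z into z - 2, the multiplier in the recurrence of [chebU]. *)
Let N : 'M[R[i]]_2 := - SLval (matA R * (matB z)^-1)%g.

Lemma mxAB_sqr : N ^+ 2 = (z - 2) *: N - 1%:M.
Proof.
rewrite /N sqrrN /= invmx_mxB expr2.
apply/matrixP => i j; rewrite !(mxE, big_ord_recl, big_ord0) /=.
by case: i => [[|[|[]]]] // ?; case: j => [[|[|[]]]] // ? /=; ring.
Qed.

Lemma mxAB_expr n :
  N ^+ n.+2 = chebU_at n.+1 z *: N - (chebU_at n z)%:M.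
Proof.
elim: n => [|n IH]; first by rewrite mxAB_sqr chebU_at1 chebU_at0.
rewrite exprS IH mulrBr -scalerAr -expr2 mxAB_sqr chebU_atSS.
rewrite -[N * _%:M]/(N *m _) mul_mx_scalar scalerBr scalerA scalerBl.
by rewrite [chebU_at n.+1 z * _]mulrC scalemx1 addrAC.
Qed.

(** At a zero, N^(n+1) is a scalar c with c^2 = det = 1; doubling the exponent removes both the sign
    of c and the sign in [N]. *)
Lemma chebU_root_torsion n : (0 < n)%N -> chebU_at n z = 0 ->
  ((matA R * (matB z)^-1) ^+ (n.+1).*2)%g = 1%g.
Proof.
case: n => // n _ pz0; apply: val_inj; rewrite [LHS]val_SL_expg.
have NE : N ^+ n.+2 = (- chebU_at n z)%:M.
  by rewrite mxAB_expr pz0 scale0r sub0r raddfN.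
have detN k : \det (N ^+ k) = 1.
  elim: k => [|k IH]; first by rewrite det1.
  rewrite exprS det_mulmx IH mulr1 /N -scaleN1r detZ expr2 mulrNN !mul1r.
  exact/eqP/SLvalP.
have sqr1 : (- chebU_at n z) ^+ 2 = 1 by rewrite -(detN n.+2) NE det_scalar.
rewrite -[SLval _]opprK -/N -mul2n exprM sqrrN -exprM mulnC exprM NE.
by rewrite expr2 -[LHS]scalar_mxM -expr2 sqr1.
Qed.

Lemma matAB_neq1 : (matA R * (matB z)^-1)%g != 1%g.
Proof.
(* The upper right entry of A B^-1 is 1 whatever z is. *)
apply/eqP => /(congr1 (fun M : SL 2 R[i] => SLval M ord0 ord_max)) /eqP.
rewrite /= invmx_mxB !(mxE, big_ord_recl, big_ord0) /=.
by rewrite mul1r mulr1 !addr0 add0r oner_eq0.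
Qed.

Lemma chebU_root_relation n : (0 < n)%N -> chebU_at n z = 0 ->
  relation_number z.
Proof.
move=> n_gt0 pz0 [f [_ f_inj f_surj]].
have : G_alpha z (matA R * (matB z)^-1)%g.
  move=> H [[_ HM HV] genH].
  by apply: HM; [|apply: HV]; apply: genH; [left|right].
move=> /f_surj[g _ fg].
(* Injectivity of [f] pulls the torsion relation back to [g]. *)
have gT : g = 1%g.
  apply: (@free_group_torsion_free _ _ (n.+1).*2) => //.
  by apply: f_inj; rewrite ?in_setT // mult_expg fg mult1g chebU_root_torsion.
by have /eqP := matAB_neq1; rewrite -fg gT mult1g.
Qed.

End Torsion.

Theorem theorem6p1 (R : realType) :
  exists (p : nat -> {poly int}),
    (forall n : nat, (1 <= n)%N -> p n \is monic /\ size (p n) = n.+1) /\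
    (forall n : nat, (1 <= n)%N ->
       let P : {poly R[i]} := map_poly intr (p n) in
       (exists s : seq R[i],
          [/\ uniq s, size s = n & forall z : R[i], root P z = (z \in s)]) /\
       (forall z : R[i], root P z -> complex.Im z = 0 /\ relation_number z)) /\
    (exists alpha : nat -> R,
       [/\ forall n : nat, (1 <= n)%N ->
             let P : {poly R[i]} := map_poly intr (p n) in
             root P (alpha n)%:C%C /\
             (forall x : R, root P x%:C%C -> x <= alpha n),
           forall n : nat, (1 <= n)%N -> alpha n < alpha n.+1
         & alpha n @[n --> \oo] --> (4 : R)]).
Proof.
exists chebU; split=> [n _|]; first exact: chebU_monic_size.
split=> [n n_gt0 P|].
  split=> [|z rz].
    exists (chebU_roots R n); split; first exact: chebU_roots_uniq.
      by rewrite size_map size_iota.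
    exact: root_chebU.
  split; last by apply: (chebU_root_relation n_gt0); exact/rootP.
  by move: rz; rewrite root_chebU => /mapP[k _ ->].
(* k = 1 gives the smallest angle pi/(n+1), hence the largest root. *)
exists (fun n => chebU_root R n 1); split=> [n n_gt0 P|n n_gt0|].
- rewrite root_chebU; split=> [|x].
    by apply: map_f; rewrite mem_iota add1n /= ltnS n_gt0.
  rewrite root_chebU => /mapP[k + /complexI ->].
  rewrite mem_iota add1n ltnS => /andP[k_gt0 le_kn].
  by rewrite leNgt chebU_root_lt ?(leqW le_kn) // ltn_pmul2r // -leqNgt.
- by rewrite chebU_root_lt // !mul1n.
- exact: chebU_root_cvg.
Qed.
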